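(* There is an absolute constant $C_1>0$ such that, writing $C_{1,\beta}=2^{-1/2}C_1(\beta^{-1}+1)$ for $\beta>0$, the following holds for $d=1$. Let $\alpha,\beta>0$ and $0<R_s\le\dfrac{\alpha^{1/8}}{2^{7/2}C_{1,\beta}^{1/4}}$. Let $f_0\in B(R_s)$ and let $f$ be the mild solution of the 6-wave kinetic equation corresponding to $f_0$ (the one satisfying $|||T^{-t}f(t)|||_{\alpha,\beta}\le 2R_s$). Then, for each choice of sign $\pm$, there exists a unique $f_\pm\in B(2R_s)$ such that $$\lim_{t\to\pm\infty}\|T^{-t}f(t)-f_\pm\|_{\alpha,\beta}=0.$$
   Context: Here $d=1$, $t\in\mathbb{R}$, $x,v\in\mathbb{R}^d$. ''Measurable'' means Borel measurable; functions of $(t,x,v)$ are jointly measurable. Spaces. $\mathcal{M}_{\alpha,\beta}$ is the space of measurable $g:\mathbb{R}^d\times\mathbb{R}^d\to\mathbb{R}$ with $\|g\|_{\alpha,\beta}:=\sup_{x,v}|g(x,v)|e^{\alpha|x|^2+\beta|v|^2}<\infty$. $L^\infty(\mathbb{R},\mathcal{M}_{\alpha,\beta})$ is the space of time-dependent functions $g(t,x,v)$ with $|||g|||_{\alpha,\beta}:=\sup_{t\in\mathbb{R}}\|g(t)\|_{\alpha,\beta}<\infty$. For $R>0$, $B(R)=\{g\in\mathcal{M}_{\alpha,\beta}:\|g\|_{\alpha,\beta}<R\}$. Transport. $(T^sg)(t,x,v):=g(t,x-sv,v)$. So $T^{-t}f(t)$ is the function $(x,v)\mapsto f(t,x+tv,v)$,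 and $T^{-s}\mathcal{C}_6[f](s,x,v)=\mathcal{C}_6[f](s,x+sv,v)$. The notation $|||T^{-t}f(t)|||_{\alpha,\beta}$ means $\sup_{t\in\mathbb{R}}\|T^{-t}f(t)\|_{\alpha,\beta}$. Equation. The 6-wave kinetic equation with initial data $f_0$ is $\partial_tf+v\cdot\nabla_xf=\mathcal{C}_6[f]$, $f(t=0)=f_0$, where $$\mathcal{C}_6[f](t,x,v)=\int_{\mathbb{R}^{5d}}\delta(\Sigma)\delta(\Omega)\Big[f_3f_4f_5(ff_1+ff_2+f_1f_2)-ff_1f_2(f_3f_4+f_3f_5+f_4f_5)\Big]dv_1\cdots dv_5,$$ $f=f(t,x,v)$, $f_i=f(t,x,v_i)$, $\Sigma=v+v_1+v_2-v_3-v_4-v_5$, $\Omega=|v|^2+|v_1|^2+|v_2|^2-|v_3|^2-|v_4|^2-|v_5|^2$. Meaning of the deltas: $\delta(\Sigma)$ sets $v_5=v+v_1+v_2-v_3-v_4$; then, for fixed $v,v_1,v_2$, with $h(v_3,v_4)$ denoting $\Omega$ after this substitution, $\int_{\mathbb{R}^{2d}}\delta(h)F\,dv_3dv_4:=\int_{\{h=0\}}\frac{F}{|\nabla h|}\,d\mathcal{H}^{2d-1}$ (surface measure on the zero set of $h$ in $\mathbb{R}^{2d}$). Mild solution. For $f_0\in\mathcal{M}_{\alpha,\beta}$, a measurable $f:\mathbb{R}\times\mathbb{R}^d\times\mathbb{R}^d\to\mathbb{R}$ is a mild solution with initial data $f_0$ if $T^{-t}f(t)\in L^\infty(\mathbb{R},\mathcal{M}_{\alpha,\beta})$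 and $T^{-t}f(t,x,v)=f_0(x,v)+\int_0^tT^{-s}\mathcal{C}_6[f](s,x,v)\,ds$ for all $t\in\mathbb{R}$. For $f_0\in B(R_s)$ with $R_s$ as in the claim, there is a unique mild solution satisfying $|||T^{-t}f(t)|||_{\alpha,\beta}\le 2R_s$. *)

(* Defs.v *)
From HB Require Import structures.
From mathcomp Require Import all_boot all_order all_algebra.
From mathcomp Require Import all_classical all_reals all_analysis.
Set Implicit Arguments.
Unset Strict Implicit.
Unset Printing Implicit Defensive.
Import Order.TTheory GRing.Theory Num.Theory.
Import numFieldNormedType.Exports.

Local Open Scope classical_set_scope.
Local Open Scope ring_scope.

Section weighted_spaces.
Context {R : realType}.
Implicit Types (alpha beta : R) (g : R -> R -> R) (f : R -> R -> R -> R).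

Definition wnorm alpha beta g : \bar R :=
  ereal_sup [set (`|g p.1 p.2| * expR (alpha * p.1 ^+ 2 + beta * p.2 ^+ 2))%:E
            | p in [set: R * R]].

Definition inM alpha beta g : Prop :=
  measurable_fun [set: R * R] (fun p : R * R => g p.1 p.2) /\
  (wnorm alpha beta g < +oo)%E.

Definition inB alpha beta (r : R) g : Prop :=
  inM alpha beta g /\ (wnorm alpha beta g < r%:E)%E.

Definition jointly_measurable f : Prop :=
  measurable_fun [set: R * R * R] (fun p : R * R * R => f p.1.1 p.1.2 p.2).

Definition tnorm alpha beta f : \bar R :=
  ereal_sup [set wnorm alpha beta (f t) | t in [set: R]].

Definition inLinftyM alpha beta f : Prop :=
  jointly_measurable f /\ (tnorm alpha beta f < +oo)%E.

Definition transport (s : R) f : R -> R -> R -> R :=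
  fun t x v => f t (x - s * v) v.

(* t |-> T^{-t} f(t) *)
Definition untransport f : R -> R -> R -> R :=
  fun t => transport (- t) f t.

End weighted_spaces.

(* The one-dimensional Hausdorff measure on the Euclidean plane. The library's
   metric on R * R is the sup metric, hence the explicit distance. As a set
   function it is an outer measure; integrals against it only evaluate it on
   Borel sets, where it is a measure. *)
Section hausdorff_measure.
Context {R : realType}.
Implicit Types (A : set (R * R)) (p q : R * R).

Definition edist p q : R :=
  Num.sqrt ((p.1 - q.1) ^+ 2 + (p.2 - q.2) ^+ 2).

(* 0 is adjoined because ereal_sup set0 = -oo *)
Definition ediam A : \bar R :=
  ereal_sup (0%E |` [set (edist p q)%:E | p in A & q in A]).

Definition hausdorff1_premeasure (delta : R) A : \bar R :=
  ereal_inf [set (\sum_(0 <= k <oo) ediam (U k))%E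
            | U in [set U : (set (R * R))^nat |
                A `<=` \bigcup_k U k /\
                forall k, (ediam (U k) <= delta%:E)%E]].

(* the normalization omega_1 / 2 is 1 *)
Definition hausdorff1 A : \bar R :=
  ereal_sup [set hausdorff1_premeasure delta A
            | delta in [set delta : R | 0 < delta]].

End hausdorff_measure.

Section collision_operator.
Context {R : realType}.
Implicit Types (h F : R * R -> R) (f : R -> R -> R -> R).

Definition grad_norm h (p : R * R) : R :=
  Num.sqrt (derive1 (fun a : R => h (a, p.2)) p.1 ^+ 2 +
            derive1 (fun b : R => h (p.1, b)) p.2 ^+ 2).

(* The integral of delta(h) F over the plane. For the h used below, grad h
   vanishes on {h = 0} only when {h = 0} is a single point, a null set. *)
Definition delta_integral h F : R :=
  fine (\int[hausdorff1]_(p in [set p | h p = 0%R])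
          (F p / grad_norm h p)%:E)%E.

Definition v5 (v v1 v2 v3 v4 : R) : R := v + v1 + v2 - v3 - v4.

Definition Omega (v v1 v2 v3 v4 v5 : R) : R :=
  v ^+ 2 + v1 ^+ 2 + v2 ^+ 2 - v3 ^+ 2 - v4 ^+ 2 - v5 ^+ 2.

Definition bracket (a a1 a2 a3 a4 a5 : R) : R :=
  a3 * a4 * a5 * (a * a1 + a * a2 + a1 * a2)
  - a * a1 * a2 * (a3 * a4 + a3 * a5 + a4 * a5).

Definition C6 f (t x v : R) : R :=
  fine (\int[(@lebesgue_measure R \x @lebesgue_measure R)%E]_w
    (delta_integral
      (fun p => Omega v w.1 w.2 p.1 p.2 (v5 v w.1 w.2 p.1 p.2))
      (fun p => bracket (f t x v) (f t x w.1) (f t x w.2)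
                  (f t x p.1) (f t x p.2)
                  (f t x (v5 v w.1 w.2 p.1 p.2))))%:E)%E.

Definition integral0 (u : R -> R) (t : R) : R :=
  if 0 <= t then \int[@lebesgue_measure R]_(s in `[0, t]) u s
  else - \int[@lebesgue_measure R]_(s in `[t, 0]) u s.

Definition mild_solution (alpha beta : R) (f0 : R -> R -> R) f : Prop :=
  [/\ jointly_measurable f,
      inLinftyM alpha beta (untransport f) &
      forall t x v : R, untransport f t x v =
        f0 x v + integral0 (fun s => transport (- s) (C6 f) s x v) t].

Definition C1beta (C1 beta : R) : R := 2 `^ (- (1 / 2)) * C1 * (beta^-1 + 1).

End collision_operator.

(* Main.v *)
Require Import Defs.
From HB Require Import structures.
From mathcomp Require Import all_boot all_order all_algebra.
From mathcomp Require Import all_classical all_reals all_analysis.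
From mathcomp Require Import measurable_realfun ring lra.
Import Order.TTheory GRing.Theory Num.Theory.
Import numFieldNormedType.Exports.
Import HBNNSimple.

Local Open Scope classical_set_scope.
Local Open Scope ring_scope.

(**
Along free transport a Gaussian bound on [f] reads
[|f s y w| <= M exp (- q w)] with [q w = al (y - s w)^2 + be w^2].  As [q] is a
combination of [1], [w] and [w^2], collisions conserve it, so each of the six
products in the collision integrand is at most
[M^5 exp (- q v) exp (- q v1) exp (- q v2)].  The resonant set in [(v3, v4)] is
an ellipse of size [rho] on which the gradient of the constraint is at least
[2 rho]: the delta integral costs an absolute constant.  Integrating over
[v1, v2] leaves [(\int exp (- q))^2 <= min (pi / be, pi / (al s^2))], which is
integrable in time, uniformly in [(x, v)].  Hence [T^{-t} f(t)] is Cauchy in the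
weighted norm, and the smallness of [Rs] bounds its distance to [f0] by [Rs].
*)

(** * Positive and negative parts below the absolute value *)

Section funeposneg_abse.
Local Open Scope ereal_scope.
Context (T : Type) (R : realType).
Implicit Types f : T -> \bar R.

Lemma funepos_le_abse f x : f^\+ x <= `|f x|.
Proof. by rewrite funeposE ge_max abse_ge0 lee_abs. Qed.

Lemma funeneg_le_abse f x : f^\- x <= `|f x|.
Proof. by rewrite funenegE ge_max abse_ge0 -abseN lee_abs. Qed.

End funeposneg_abse.

(** * Integrals without measurability *)

(* The library's integral of an arbitrary function is the lower integral of its
   positive part minus that of its negative part.  Lower integrals are monotone
   and subadditive in the domain, which is all that is used about [C6 f]: its
   measurability is never needed. *)
Section lower_integral.
Local Open Scope ereal_scope.
Context d (T : measurableType d) (R : realType).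
Variable mu : {measure set T -> \bar R}.
Implicit Types (f g : T -> \bar R) (A B D : set T).

Lemma le_lower_integral A B f g :
  (forall x, A x -> 0 <= f x) -> (forall x, B x -> 0 <= g x) -> A `<=` B ->
  (forall x, A x -> f x <= g x) ->
  \int[mu]_(x in A) f x <= \int[mu]_(x in B) g x.
Proof.
move=> f0 g0 AB fg; rewrite !ge0_integralE//.
apply: ereal_sup_le => _ [h /= hf <-]; exists h => //= x.
apply: (le_trans (hf x)); rewrite !patchE.
case: ifPn => [/set_mem Ax|_]; first by rewrite mem_set ?fg//; exact: AB.
by case: ifPn => [/set_mem/g0//|_].
Qed.

(** A simple function [h] below [f] extended by zero vanishes off [B]. Being measurable, it has an
    integral additive over [A] and its complement in [B], and each piece is below the corresponding
    lower integral. Only the sets and [h] have to be measurable. *)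
Lemma lower_integral_setD A B f g : measurable A -> measurable B -> A `<=` B ->
  (forall x, B x -> 0 <= f x) -> (forall x, B x -> f x <= g x) ->
  \int[mu]_(x in B) f x <=
    \int[mu]_(x in A) f x + \int[mu]_(x in B `\` A) g x.
Proof.
move=> mA mB AB f0 fg.
rewrite [leLHS]ge0_integralE//; apply: ge_ereal_sup => _ [h /= hf <-].
have mh : measurable_fun setT (EFin \o (h : T -> R)) by exact/measurable_EFinP.
have hE : (h \_ B)%R = h :> (T -> R).
  apply/funext => x; rewrite patchE; case: ifPn => // xB.
  apply/eqP; rewrite eq_le fun_ge0 -lee_fin.
  by have := hf x; rewrite patchE (negbTE xB).
have hB x : B x -> (h x)%:E <= f x.
  by move=> Bx; have := hf x; rewrite patchE mem_set.
rewrite -[in leLHS]hE -integral_nnsfun//.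
rewrite -[X in integral _ X _](setDUK AB) ge0_integral_setU//=.
- apply: leeD; apply: le_lower_integral => //.
  + by move=> x _; rewrite lee_fin.
  + by move=> x /AB /f0.
  + by move=> x /AB /hB.
  + by move=> x _; rewrite lee_fin.
  + by move=> x [Bx _]; exact: le_trans (f0 _ Bx) (fg _ Bx).
  + by move=> x [Bx _]; exact: le_trans (hB _ Bx) (fg _ Bx).
- exact: measurableD.
- exact: measurable_funS mh.
- by move=> x _; rewrite lee_fin.
- by rewrite /disj_set setDIK.
Qed.

Lemma lower_integral_pos_neg D (u : T -> R) (g : T -> \bar R) :
  (forall x, D x -> `|u x|%:E <= g x) ->
  ((forall x, D x -> 0 <= (EFin \o u)^\+ x <= g x) *
   (forall x, D x -> 0 <= (EFin \o u)^\- x <= g x))%type.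
Proof.
move=> ug; split=> x Dx; rewrite ?(funepos_ge0, funeneg_ge0)/=;
  apply: le_trans (ug x Dx); [exact: funepos_le_abse|exact: funeneg_le_abse].
Qed.

(** The integrals of the positive and negative parts are finite and both lie in [[0, K]], so their
    difference has size at most [K], with no factor 2. *)
Lemma Rintegral_le_dom D (u : T -> R) (g : T -> \bar R) (K : R) :
  (forall x, D x -> `|u x|%:E <= g x) -> \int[mu]_(x in D) g x <= K%:E ->
  (`|\int[mu]_(x in D) u x| <= K)%R.
Proof.
move=> ug gK; have [up un] := lower_integral_pos_neg D u g ug.
rewrite /Rintegral integralE.
have bnd F : (forall x, D x -> 0 <= F x <= g x) ->
    exists2 r, \int[mu]_(x in D) F x = r%:E & (0 <= r <= K)%R.
  move=> Fg.
  have F0 : 0 <= \int[mu]_(x in D) F x.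
    by apply: integral_ge0 => x /Fg/andP[].
  have FK : \int[mu]_(x in D) F x <= K%:E.
    apply: le_trans gK; apply: le_lower_integral => // x Dx;
      have /andP[] := Fg x Dx => //.
    exact: le_trans.
  case: (integral _ _ _) F0 FK => //= r; rewrite !lee_fin => r0 rK.
  by exists r; rewrite ?r0.
have [p -> /andP[p0 pK]] := bnd _ up; have [n -> /andP[n0 nK]] := bnd _ un.
by rewrite /= ler_norml; apply/andP; split; lra.
Qed.

(** For each of the two signed parts, passing from [A] to [B] increases the integral by an amount in
    [[0, K]]. The constant [K'] serves only to make all integrals finite, so that [fine] does not
    replace an infinite value by 0. *)
Lemma Rintegral_setD_dom A B (u : T -> R) (g : T -> \bar R) (K K' : R) :
  measurable A -> measurable B -> A `<=` B ->
  (forall x, B x -> `|u x|%:E <= g x) ->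
  \int[mu]_(x in B) g x <= K'%:E -> \int[mu]_(x in B `\` A) g x <= K%:E ->
  (`|\int[mu]_(x in B) u x - \int[mu]_(x in A) u x| <= K)%R.
Proof.
move=> mA mB AB ug gK' gK; have [up un] := lower_integral_pos_neg B u g ug.
rewrite /Rintegral integralE [in X in (_ - fine X)%R]integralE.
have bnd F : (forall x, B x -> 0 <= F x <= g x) -> exists b a : R,
    [/\ \int[mu]_(x in B) F x = b%:E, \int[mu]_(x in A) F x = a%:E &
        (0 <= b - a <= K)%R].
  move=> Fg.
  have F0 x : B x -> 0 <= F x by move=> /Fg/andP[].
  have FAx x : A x -> 0 <= F x by move=> /AB /F0.
  have Fle x : B x -> F x <= g x by move=> /Fg/andP[].
  have FA : 0 <= \int[mu]_(x in A) F x by exact: integral_ge0.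
  have FB : 0 <= \int[mu]_(x in B) F x by exact: integral_ge0.
  have FAB : \int[mu]_(x in A) F x <= \int[mu]_(x in B) F x.
    exact: le_lower_integral.
  have FK' : \int[mu]_(x in B) F x <= K'%:E.
    apply: le_trans gK'; apply: le_lower_integral => // x Bx.
    exact: le_trans (F0 _ Bx) (Fle _ Bx).
  have := lower_integral_setD A B F g mA mB AB F0 Fle.
  move=> /le_trans/(_ (leeD (le_refl _) gK)).
  move: FA FB FAB FK'.
  case: (\int[mu]_(x in B) F x) => [b||] //; case: (\int[mu]_(x in A) F x) => [a||] //.
  move=> a0 b0; rewrite -EFinD !lee_fin => ab _ baK; exists b, a; split => //.
  by apply/andP; split; lra.
have [p [p' [-> -> /andP[p0 pK]]]] := bnd _ up.
have [n [n' [-> -> /andP[n0 nK]]]] := bnd _ un.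
by rewrite /= ler_norml; apply/andP; split; lra.
Qed.

End lower_integral.

(* [hausdorff1] is only a set function.  Bounding it on subsets of [Z] by a
   measure through the parametrization [gam] replaces its additivity. *)
Section set_function_integral.
Local Open Scope ereal_scope.
Context d d' (T : measurableType d) (T' : measurableType d') (R : realType).
Variables (mu : {measure set T -> \bar R}) (nu : set T' -> \bar R).
Hypotheses (nu0 : nu set0 = 0) (nu_ge0 : forall A, 0 <= nu A).

Lemma fine_integral_pushforward_le (Z : set T') (gam : T -> T') (B : set T)
    (L M m : R) (F : T' -> R) :
  measurable_fun setT gam -> measurable B -> mu B = m%:E ->
  (0 <= L)%R -> (0 <= M)%R ->
  (forall A, measurable A -> A `<=` Z -> nu A <= L%:E * mu (B `&` gam @^-1` A)) ->
  (forall p, Z p -> `|F p| <= M)%R ->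
  (`|fine (\int[nu]_(p in Z) (F p)%:E)| <= M * L * m)%R.
Proof.
move=> mgam mB muB L0 M0 nuL FM.
have m0 : (0 <= m)%R by rewrite -lee_fin -muB.
suff bnd (g : T' -> \bar R) : (forall p, ~ Z p -> g p = 0) ->
    (forall p, 0 <= g p <= M%:E) -> exists2 r : R,
     ereal_sup [set sintegral nu h |
       h in [set h : {nnsfun T' >-> R} | forall x, (h x)%:E <= g x]] = r%:E &
     (0 <= r <= M * L * m)%R.
  rewrite /integral.
  have gZ p : ~ Z p -> ((fun p => (F p)%:E) \_ Z) p = 0.
    by move=> Zp; rewrite patchE memNset.
  have gM p : `|((fun p => (F p)%:E) \_ Z) p| <= M%:E.
    rewrite patchE; case: ifPn => [/set_mem/FM//|_].
    by rewrite abse0.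
  have [||p -> /andP[p0 pM]] := bnd (((fun p => (F p)%:E) \_ Z)^\+).
  - by move=> p /gZ; rewrite funeposE => ->; rewrite maxxx.
  - move=> p; rewrite funepos_ge0/=; apply: le_trans (gM p).
    exact: funepos_le_abse.
  have [||n -> /andP[n0 nM]] := bnd (((fun p => (F p)%:E) \_ Z)^\-).
  - by move=> x /gZ; rewrite funenegE => ->; rewrite oppe0 maxxx.
  - move=> x; rewrite funeneg_ge0/=; apply: le_trans (gM x).
    exact: funeneg_le_abse.
  by rewrite /= ler_norml; apply/andP; split; lra.
move=> gZ gM.
(* Values outside the range have empty level sets, which [nu0] discards; the sum becomes one over a
   finite set. *)
have sE (h : {nnsfun T' >-> R}) :
    sintegral nu h = \sum_(x \in range h) x%:E * nu (h @^-1` [set x]).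
  rewrite /sintegral (fsbig_widen (range h) setT)//= => x [_ Nfx] /=.
  by rewrite preimage10// nu0 mule0.
have lb : 0 <= ereal_sup [set sintegral nu h |
    h in [set h : {nnsfun T' >-> R} | forall x, (h x)%:E <= g x]].
  apply: ereal_sup_ubound; exists nnsfun0.
    by move=> x; case/andP: (gM x).
  by rewrite (sE nnsfun0) fsbig1// => r [x _ <-]; rewrite mul0e.
have ub : ereal_sup [set sintegral nu h |
    h in [set h : {nnsfun T' >-> R} | forall x, (h x)%:E <= g x]]
    <= (M * L * m)%:E.
  apply: ge_ereal_sup => _ [h /= hg <-]; rewrite sE.
  have mhr r : measurable (B `&` gam @^-1` (h @^-1` [set r])).
    apply: measurableI => //; rewrite -[X in measurable X]setTI.
    exact: mgam.
  apply: (@le_trans _ _ (\sum_(r \in range h)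
      (M * L)%:E * mu (B `&` gam @^-1` (h @^-1` [set r])))).
    apply: lee_fsum => // _ [p _ <-].
    have [hp0|hp0] := eqVneq (h p) 0%R.
      by rewrite hp0 mul0e mule_ge0// lee_fin mulr_ge0.
    rewrite EFinM -muleA; apply: lee_pmul => //.
    - by rewrite lee_fin.
    - by apply: (le_trans (hg p)); case/andP: (gM p).
    (* A level set of a nonzero value lies in [Z], because [0 <= h <= g] and [g] vanishes off
       [Z]. *)
    - apply: nuL => // x /= xp; apply: contrapT => /gZ gx.
      by have := hg x; rewrite gx xp lee_fin => hp; move/negP: hp0; apply;
        rewrite eq_le hp fun_ge0.
  rewrite -ge0_mule_fsumr// [leRHS]EFinM -muB.
  apply: lee_wpmul2l; first by rewrite lee_fin mulr_ge0.
  (* The level sets of [h \o gam] are disjoint, so their traces on [B] have total measure at most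
     [mu B]. *)
  rewrite -measure_fsbig//.
    rewrite fsbig_setU//; apply: le_measure; rewrite ?inE//.
      by apply: fin_bigcup_measurable.
    by move=> x [r _ []].
  exact/trivIset_setIl/(@trivIset_preimage1 _ _ _ (h \o gam)).
case: (ereal_sup _) lb ub => // r; rewrite !lee_fin => r0 rM.
by exists r; rewrite ?r0.
Qed.

End set_function_integral.

(** * Hausdorff measure of Lipschitz curves *)

Section hausdorff1_theory.
Context (R : realType).
Implicit Types (A B : set (R * R)) (delta : R).

Lemma ediam_ge0 A : (0 <= ediam A)%E.
Proof. by apply: ereal_sup_ubound; left. Qed.

Lemma ediam_le A (r : R) : 0 <= r ->
  (forall p q, A p -> A q -> Defs.edist p q <= r) -> (ediam A <= r%:E)%E.
Proof.
move=> r0 Ar; apply: ge_ereal_sup => x [->|[p Ap] [q Aq] <-].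
  by rewrite lee_fin.
by rewrite lee_fin Ar.
Qed.

Lemma hausdorff1_premeasure_ge0 delta A : (0 <= hausdorff1_premeasure delta A)%E.
Proof.
apply: le_ereal_inf_tmp => _ [U _ <-].
by apply: nneseries_ge0 => n _ _; exact: ediam_ge0.
Qed.

Lemma hausdorff1_ge0 A : (0 <= hausdorff1 A)%E.
Proof.
apply: le_trans (hausdorff1_premeasure_ge0 1 A) _.
by apply: ereal_sup_ubound; exists 1 => //=.
Qed.

(** Two covers that are optimal up to [e / 2] are merged into one cover of the union; an infinite
    premeasure is set apart first. *)
Lemma hausdorff1_premeasureU delta A B :
  (hausdorff1_premeasure delta (A `|` B) <=
   hausdorff1_premeasure delta A + hausdorff1_premeasure delta B)%E.
Proof.
have [->|Afin] := eqVneq (hausdorff1_premeasure delta A) +oo%E.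
  by rewrite addye ?leey// gt_eqF//
    (lt_le_trans _ (hausdorff1_premeasure_ge0 _ _)) ?ltNyr.
have [->|Bfin] := eqVneq (hausdorff1_premeasure delta B) +oo%E.
  by rewrite addey ?leey// gt_eqF//
    (lt_le_trans _ (hausdorff1_premeasure_ge0 _ _)) ?ltNyr.
have fin X : hausdorff1_premeasure delta X != +oo%E ->
    hausdorff1_premeasure delta X \is a fin_num.
  by move=> Xy; rewrite ge0_fin_numE ?hausdorff1_premeasure_ge0// ltey.
apply/lee_addgt0Pr => e e0.
have e20 : 0 < e / 2 by rewrite divr_gt0.
have [_ [U [AU dU] <-] ltU] := lb_ereal_inf_adherent e20 (fin _ Afin).
have [_ [V [BV dV] <-] ltV] := lb_ereal_inf_adherent e20 (fin _ Bfin).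
(* Interleaving: [U] sits at the even indices and [V] at the odd ones, so the first [2 n] terms of
   [W] are the first [n] of each. *)
pose W n := if odd n then V n./2 else U n./2.
have W0 n : (0 <= ediam (W n))%E by exact: ediam_ge0.
have WUV : (\sum_(0 <= k <oo) ediam (W k) <=
   \sum_(0 <= k <oo) ediam (U k) + \sum_(0 <= k <oo) ediam (V k))%E.
  apply: lime_le; first exact: is_cvg_nneseries.
  apply: nearW => n.
  apply: (@le_trans _ _ (\sum_(0 <= k < n.*2) ediam (W k))%E).
    by apply: lee_sum_nneg_natr => //; rewrite -addnn leq_addr.
  have -> : (\sum_(0 <= k < n.*2) ediam (W k) =
     \sum_(0 <= k < n) ediam (U k) + \sum_(0 <= k < n) ediam (V k))%E.
    elim: n => [|n IH]; first by rewrite !big_nil adde0.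
    rewrite doubleS !big_nat_recr//= IH /W /= odd_double /= doubleK uphalf_double.
    by rewrite -addeA addeACA addeA.
  by apply: leeD; apply: nneseries_lim_ge => *; exact: ediam_ge0.
apply: (@le_trans _ _ (\sum_(0 <= k <oo) ediam (W k))%E).
  apply: ereal_inf_lbound; exists W => //; split.
    move=> x [/AU[n _ Un]|/BV[n _ Vn]].
      by exists n.*2 => //; rewrite /W odd_double doubleK.
    by exists n.*2.+1 => //; rewrite /W /= odd_double /= uphalf_double.
  by move=> k; rewrite /W; case: ifP.
apply: (le_trans WUV); rewrite [e in leRHS]splitr EFinD addeACA.
by apply: leeD; exact: ltW.
Qed.

(** By construction Lebesgue measure is the outer measure given by half-open intervals; this form
    lets interval covers be pushed forward by a curve. *)
Lemma lebesgue_measure_inf (B : set R) : lebesgue_measure B =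
  ereal_inf [set (\sum_(0 <= k <oo) wlength idfun (F k))%E |
             F in @measurable_cover _ (ocitv_type R) B].
Proof. by []. Qed.

Variables (gam : R -> R * R) (L : R).
Hypotheses (L0 : 0 < L)
  (gamL : forall s t, Defs.edist (gam s) (gam t) <= L * `|s - t|).

(** The curve maps a cover by intervals to a cover by sets of diameter at most [L] times their
    lengths. Cutting each interval to the window [[c, c + eta]] also keeps these diameters below
    [delta]. *)
Let premeasure_small delta (B : set R) (c eta : R) : 0 <= eta ->
  L * eta <= delta -> B `<=` `[c, c + eta] ->
  (hausdorff1_premeasure delta (gam @` B) <= L%:E * lebesgue_measure B)%E.
Proof.
move=> eta0 Leta Bc; rewrite -lee_pdivrMl// lebesgue_measure_inf.
apply: le_ereal_inf_tmp => _ [F [mF BF] <-]; rewrite lee_pdivrMl//.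
pose J := `[c, c + eta]%classic.
rewrite -nneseriesZl//.
pose U k := gam @` (F k `&` J).
apply: (@le_trans _ _ (\sum_(0 <= k <oo) ediam (U k))%E).
  apply: ereal_inf_lbound; exists U => //; split.
    move=> _ [s Bs <-]; have [k _ Fks] := BF _ Bs.
    by exists k => //; exists s => //; split => //; exact: Bc.
  move=> k; apply: ediam_le; first by apply: le_trans Leta; rewrite mulr_ge0// ltW.
  move=> _ _ [s [_ Js] <-] [t [_ Jt] <-]; apply: (le_trans (gamL _ _)).
  apply: le_trans Leta; rewrite ler_pM2l//.
  move: Js Jt; rewrite /J /= !in_itv/= => /andP[? ?] /andP[? ?].
  by rewrite ler_norml; apply/andP; split; lra.
apply: lee_nneseries => [k _ _|k _]; first exact: ediam_ge0.
have /ocitvP[Fk0|[[x y] /= xy Fkxy]] := mF k.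
  rewrite /U Fk0 set0I image_set0 wlength0 mule0.
  by apply: ediam_le => //.
rewrite Fkxy wlength_itv_bnd/=; last exact: ltW.
rewrite -EFinM; apply: ediam_le; first by rewrite mulr_ge0 ?subr_ge0 ?ltW.
move=> _ _ [s [Fs _] <-] [t [Ft _] <-]; apply: (le_trans (gamL _ _)).
rewrite ler_pM2l//.
move: Fs Ft; rewrite Fkxy /= !in_itv/= => /andP[? ?] /andP[? ?].
by rewrite ler_norml; apply/andP; split; lra.
Qed.

Lemma hausdorff1_lipschitz (B : set R) (a b : R) : measurable B ->
  B `<=` `[a, b] -> (hausdorff1 (gam @` B) <= L%:E * lebesgue_measure B)%E.
Proof.
move=> mB Bab; apply: ge_ereal_sup => _ [delta /= d0 <-].
pose eta := delta / L.
have eta0 : 0 < eta by rewrite divr_gt0.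
have Leta : L * eta <= delta by rewrite mulrC divfK// gt_eqF.
(* Induction on the number of windows of width [eta]: subadditivity of the premeasure on one side,
   additivity of Lebesgue measure on the other. *)
suff H n (C : set R) : measurable C -> C `<=` `[a, a + eta *+ n] ->
    (hausdorff1_premeasure delta (gam @` C) <= L%:E * lebesgue_measure C)%E.
  have /archi_boundP := normr_ge0 ((b - a) / eta).
  set n := Num.bound _ => nb; apply: (H n) => // x /Bab.
  rewrite /= !in_itv/= => /andP[-> xb]/=; apply: (le_trans xb).
  rewrite -lerBlDl -mulr_natl -ler_pdivrMr//; apply: le_trans (ltW nb).
  exact: ler_norm.
elim: n C => [|n IH] C mC Ca.
  apply: (premeasure_small _ _ a 0) => //; first by rewrite mulr0 ltW.
pose C1 := C `&` `[a, a + eta *+ n].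
have mC1 : measurable C1 by exact: measurableI.
have mC2 : measurable (C `\` C1) by exact: measurableD.
have C1C : C1 `<=` C by move=> x [].
rewrite -[in leLHS](setDUK C1C) image_setU.
apply: (le_trans (hausdorff1_premeasureU _ _ _)).
apply: (@le_trans _ _
  (L%:E * lebesgue_measure C1 + L%:E * lebesgue_measure (C `\` C1))%E).
  apply: leeD; first by apply: IH => // x [].
  apply: (premeasure_small _ _ (a + eta *+ n) eta) => //; first exact: ltW.
  move=> x [Cx nCx]; have := Ca _ Cx; rewrite /= !in_itv/= mulrSr addrA => /andP[ax ->].
  rewrite andbT leNgt; apply/negP => xa; apply: nCx; split => //.
  by rewrite /= in_itv/= ax ltW.
rewrite -ge0_muleDr//; apply: lee_wpmul2l; first by rewrite lee_fin ltW.
by rewrite -measureU// ?setDUK// setDIK.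
Qed.

End hausdorff1_theory.

(** * The delta integral *)

Section collision_curve.
Context (R : realType).

Lemma derive1_quadratic (c0 c1 c2 x : R) :
  derive1 (fun a => c0 + c1 * a + c2 * a ^+ 2) x = c1 + c2 * 2 * x.
Proof.
rewrite derive1E.
have idx : is_derive x 1 (@id R) 1 := is_derive_id x 1.
have H := is_deriveD (is_deriveD (is_derive_cst c0 x 1) (is_deriveZ c1 idx))
  (is_deriveZ c2 (is_deriveX 2 idx)).
transitivity ('D_1 (cst c0 + c1 \*: (@id R) + c2 \*: ((@id R) ^+ 2)) x); first by [].
rewrite (@derive_val _ _ _ _ _ _ _ H) /GRing.scale/=; ring.
Qed.

Lemma cos_sin_surj (a b : R) : a ^+ 2 + b ^+ 2 = 1 ->
  exists2 theta, - pi <= theta <= pi & cos theta = a /\ sin theta = b.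
Proof.
move=> ab1.
have a1 : a ^+ 2 <= 1 by rewrite -ab1 lerDl sqr_ge0.
have a11 : -1 <= a <= 1.
  by rewrite -ler_norml -(@ler_pXn2r _ 2)// ?nnegrE// real_normK ?num_real// expr1n.
have sE : sin (acos a) = `|b|.
  by rewrite sin_acos// -ab1 addrAC subrr add0r sqrtr_sqr.
have pi0 := pi_ge0 R.
have api := acos_lepi a11; have a0 := acos_ge0 a11.
have [b0|b0] := leP 0 b.
  exists (acos a); first by apply/andP; split; lra.
  by rewrite acosK// sE ger0_norm.
exists (- acos a); first by apply/andP; split; lra.
by rewrite cosN sinN acosK// sE ltr0_norm// opprK.
Qed.

Lemma derivative_le1_lipschitz (f df : R -> R) :
  (forall x : R, is_derive x 1 f (df x)) -> (forall x, `|df x| <= 1) ->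
  forall s t, `|f s - f t| <= `|s - t|.
Proof.
move=> fdf df1 s t; wlog st : s t / s <= t.
  move=> H; have [/H//|/ltW/H] := leP s t.
  by rewrite distrC (distrC t).
have fc : {within `[s, t], continuous f}.
  by apply: derivable_within_continuous => x _; exact: ex_derive.
have [c _ fE] := @MVT_segment R f df s t st (fun x _ => fdf x) fc.
by rewrite distrC (distrC s) fE normrM ler_piMl.
Qed.


Lemma hausdorff1_set0 : hausdorff1 (set0 : set (R * R)) = 0%E.
Proof.
apply/eqP; rewrite eq_le hausdorff1_ge0 andbT.
have -> : set0 = (fun=> (0, 0) : R * R) @` (set0 : set R) by rewrite image_set0.
have gam1 (s t : R) : Defs.edist (0, 0) (0, 0 : R) <= 1 * `|s - t|.
  by rewrite /Defs.edist/= !subrr expr0n/= addr0 sqrtr0 mul1r.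
have := hausdorff1_lipschitz R _ 1 ltr01 gam1 set0 0 0 measurable0 (sub0set _).
by rewrite measure0 mule0.
Qed.

(** The positive and negative parts of the zero function are the same function, so their integrals
    cancel for an arbitrary set function; were they infinite, [fine] would still return 0. *)
Lemma fine_integral0 d (T : measurableType d) (nu : set T -> \bar R) (Z : set T)
    (F : T -> R) : (forall x, Z x -> F x = 0) ->
  fine (\int[nu]_(x in Z) (F x)%:E)%E = 0.
Proof.
move=> F0; rewrite /integral.
have -> : ((fun x => (F x)%:E) \_ Z = cst 0)%E.
  by apply/funext => x; rewrite patchE; case: ifPn => [/set_mem/F0 ->|].
have -> : ((cst 0)^\+ = (cst 0)^\- :> (T -> \bar R))%E.
  by apply/funext => x; rewrite funeposE funenegE oppe0.
by case: (ereal_sup _) => // r; rewrite subee.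
Qed.

(** * The resonant ellipse and its parametrization *)

Section ellipse.
Variables v v1 v2 : R.

Let S := v + v1 + v2.
Let E := v ^+ 2 + v1 ^+ 2 + v2 ^+ 2.
Let rho := Num.sqrt (E - S ^+ 2 / 3).
Let h (p : R * R) := Omega v v1 v2 p.1 p.2 (v5 v v1 v2 p.1 p.2).

(** [3 E - S^2] is the sum of the squared differences of [v], [v1], [v2], so the radicand is
    nonnegative. *)
Let rho2 : rho ^+ 2 = E - S ^+ 2 / 3.
Proof.
rewrite sqr_sqrtr// /E /S.
have := sqr_ge0 (v - v1); have := sqr_ge0 (v - v2); have := sqr_ge0 (v1 - v2).
nra.
Qed.

Let rho0 : 0 <= rho. Proof. exact: sqrtr_ge0. Qed.

Let a := (Num.sqrt 2 : R)^-1.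
Let b := (Num.sqrt 6 : R)^-1.

Let a2 : a ^+ 2 = 2^-1. Proof. by rewrite exprVn sqr_sqrtr. Qed.
Let b2 : b ^+ 2 = 6^-1. Proof. by rewrite exprVn sqr_sqrtr. Qed.

(* The circle of radius [rho] centered at [(S / 3, S / 3, S / 3)] in the plane
   [v3 + v4 + v5 = S], in the orthonormal directions [(1, -1, 0) / sqrt 2] and
   [(1, 1, -2) / sqrt 6], projected to [(v3, v4)]. *)
Definition collision_curve (th : R) : R * R :=
  (S / 3 + rho * (a * cos th + b * sin th),
   S / 3 + rho * (- (a * cos th) + b * sin th)).

(** The squared distance is [rho^2 (dc^2 + ds^2 / 3)], with [dc] and [ds] the increments of cosine
    and sine. The rounded constant [2 rho] matches the lower bound on the gradient. *)
Lemma collision_curve_lipschitz s t :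
  Defs.edist (collision_curve s) (collision_curve t) <= 2 * rho * `|s - t|.
Proof.
rewrite /Defs.edist/= -[leRHS]ger0_norm; last by rewrite !mulr_ge0.
rewrite -sqrtr_sqr ler_wsqrtr//.
have -> : (2 * rho * `|s - t|) ^+ 2 = 4 * rho ^+ 2 * (s - t) ^+ 2.
  by rewrite !exprMn real_normK ?num_real//; ring.
set dc := cos s - cos t; set ds := sin s - sin t.
have -> : (S / 3 + rho * (a * cos s + b * sin s) -
   (S / 3 + rho * (a * cos t + b * sin t))) ^+ 2 +
  (S / 3 + rho * (- (a * cos s) + b * sin s) -
   (S / 3 + rho * (- (a * cos t) + b * sin t))) ^+ 2 =
  rho ^+ 2 * (2 * a ^+ 2 * dc ^+ 2 + 2 * b ^+ 2 * ds ^+ 2).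
  by rewrite /dc /ds; ring.
rewrite a2 b2.
have sq (x y : R) : `|x| <= `|y| -> x ^+ 2 <= y ^+ 2.
  move=> xy; rewrite -(real_normK (num_real x)) -(real_normK (num_real y)).
  by rewrite ler_pXn2r ?nnegrE.
have dcs : dc ^+ 2 <= (s - t) ^+ 2.
  apply/sq/(derivative_le1_lipschitz cos (fun x => - sin x)) => x.
  by rewrite normrN sin_max.
have dss : ds ^+ 2 <= (s - t) ^+ 2.
  by apply/sq/(derivative_le1_lipschitz sin cos) => x; exact: cos_max.
have := sqr_ge0 rho; have := sqr_ge0 (s - t) => st0 r0.
rewrite [leRHS](_ : _ = rho ^+ 2 * (4 * (s - t) ^+ 2)); last by ring.
apply: ler_wpM2l => //; lra.
Qed.

Lemma collision_curve_surj p : h p = 0 ->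
  exists2 th, - pi <= th <= pi & collision_curve th = p.
Proof.
case: p => x y; rewrite /h/= => hp.
pose u := x - S / 3; pose w := y - S / 3.
(* The constraint in coordinates centered at [(S / 3, S / 3)]. *)
have uw : 2 * (u ^+ 2 + u * w + w ^+ 2) = rho ^+ 2.
  rewrite rho2 /u /w /E /S; move: hp; rewrite /Omega /v5 => hp; lra.
have [r0|r0] := eqVneq rho 0.
  exists 0; first by rewrite oppr_le0 pi_ge0.
  rewrite /collision_curve r0 !mul0r addr0.
  move: uw; rewrite r0 expr0n/= => uw.
  have sq0 := sqr_ge0 u; have sq1 := sqr_ge0 w; have sq2 := sqr_ge0 (u + w).
  have : u = 0 /\ w = 0.
    by split; apply/eqP; rewrite -sqrf_eq0; apply/eqP; nra.
  by rewrite /u /w => -[/subr0_eq -> /subr0_eq ->].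
(* Solving [u - w = 2 rho a cos th] and [u + w = 2 rho b sin th], with [1 / (2 a) = a] and
   [1 / (2 b) = 3 b]. *)
have [|th thp [cE sE]] := @cos_sin_surj ((u - w) * a / rho) (3 * b * (u + w) / rho).
  rewrite !exprMn a2 b2 (exprVn rho) -mulrDl.
  apply: (canLR (mulfK _)); first by rewrite expf_neq0.
  rewrite mul1r -uw; lra.
exists th => //; rewrite /collision_curve cE sE.
have -> : a * ((u - w) * a / rho) = a ^+ 2 * (u - w) / rho by ring.
have -> : b * (3 * b * (u + w) / rho) = 3 * b ^+ 2 * (u + w) / rho by ring.
rewrite a2 b2; congr pair; rewrite /u /w; field => //.
Qed.

Lemma grad_normE x y : grad_norm h (x, y) =
  Num.sqrt ((2 * (S - y) - 4 * x) ^+ 2 + (2 * (S - x) - 4 * y) ^+ 2).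
Proof.
rewrite /grad_norm/h/=.
have hx : (fun z => Omega v v1 v2 z y (v5 v v1 v2 z y)) =
  (fun z => (E - y ^+ 2 - (S - y) ^+ 2) + 2 * (S - y) * z + (-2) * z ^+ 2).
  by apply/funext => z; rewrite /Omega /v5 /E /S; ring.
have hy : (fun z => Omega v v1 v2 x z (v5 v v1 v2 x z)) =
  (fun z => (E - x ^+ 2 - (S - x) ^+ 2) + 2 * (S - x) * z + (-2) * z ^+ 2).
  by apply/funext => z; rewrite /Omega /v5 /E /S; ring.
rewrite hx hy !derive1_quadratic; congr Num.sqrt; ring.
Qed.

Lemma measurable_collision_curve :
  measurable_fun (setT : set (measurableTypeR R)) collision_curve.
Proof.
have mc : measurable_fun (setT : set (measurableTypeR R)) (@cos R).
  by apply: continuous_measurable_fun; exact: continuous_cos.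
have ms : measurable_fun (setT : set (measurableTypeR R)) (@sin R).
  by apply: continuous_measurable_fun; exact: continuous_sin.
apply/measurable_fun_pair => /=; apply: measurable_funD => //;
  apply: measurable_funM => //; apply: measurable_funD => //;
  try apply: measurable_funN; by apply: measurable_funM.
Qed.

(** On the zero set the squared gradient norm exceeds [4 rho^2] by [(4 / 3) (x + y - 2 z)^2], where
    [z] is the fifth velocity. *)
Lemma le_grad_norm p : h p = 0 -> 2 * rho <= grad_norm h p.
Proof.
case: p => x y; rewrite /h/= => hp; rewrite grad_normE.
rewrite -[leLHS]ger0_norm; last by rewrite mulr_ge0.
rewrite -sqrtr_sqr ler_wsqrtr// exprMn rho2.
move: hp; rewrite /Omega /v5 /E /S => hp.
have := sqr_ge0 (x + y - 2 * (v + v1 + v2 - x - y)).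
nra.
Qed.

(** The Lipschitz constant [2 rho] of the curve cancels the bound [1 / (2 rho)] on the inverse
    gradient; what remains is the length [2 pi] of the parameter interval. *)
Lemma delta_integral_le (F : R * R -> R) (B : R) : 0 <= B ->
  (forall p, h p = 0 -> `|F p| <= B) ->
  `|delta_integral h F| <= 2 * pi * B.
Proof.
move=> B0 FB; have [r0|r0] := eqVneq rho 0.
  rewrite /delta_integral fine_integral0; first by rewrite normr0 !mulr_ge0 ?pi_ge0.
  (* For [rho = 0] the ellipse is a point where the gradient vanishes, and the convention [0^-1 = 0]
     makes the integrand zero there. *)
  move=> [x y] /= hp; suff -> : grad_norm h (x, y) = 0 by rewrite invr0 mulr0.
  have [th _ [xE yE]] := collision_curve_surj _ hp.
  move: xE yE; rewrite r0 !mul0r addr0 => xE yE.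
  rewrite grad_normE -xE -yE /S -[RHS]sqrtr0.
  by congr Num.sqrt; field.
have rho_gt0 : 0 < rho by rewrite lt0r r0 sqrtr_ge0.
have L0 : 0 < 2 * rho by rewrite mulr_gt0.
have -> : 2 * pi * B = B / (2 * rho) * (2 * rho) * (2 * pi) by field.
pose J : set R := `[- pi, pi]%classic.
apply: (@fine_integral_pushforward_le _ _ (measurableTypeR R) _ R lebesgue_measure
  hausdorff1 hausdorff1_set0 (@hausdorff1_ge0 R) _ collision_curve J).
- exact: measurable_collision_curve.
- exact: measurable_itv.
- have pi0 := pi_gt0 R.
  apply: (etrans (lebesgue_measure_itv (Interval (BLeft (- pi : R)) (BRight (pi : R))))).
  rewrite /= lte_fin ifT; last by lra.
  by rewrite -EFinD; congr EFin; ring.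
- exact: ltW.
- by rewrite divr_ge0// ltW.
- move=> A mA AZ.
  (* As the curve covers the zero set, [A] is the image of its own preimage in [J]. *)
  rewrite -[in leLHS](_ : collision_curve @` (J `&` collision_curve @^-1` A) = A).
    apply: (hausdorff1_lipschitz R _ _ L0 collision_curve_lipschitz _ (- pi) pi).
      apply: measurableI; first exact: measurable_itv.
      by rewrite -[X in measurable X]setTI; exact: measurable_collision_curve.
    by move=> x [].
  apply/seteqP; split=> [_ [th [_ Ath] <-]//|p Ap].
  have [th thp thE] := collision_curve_surj _ (AZ _ Ap).
  by exists th => //; split; rewrite /= ?thE// in_itv.
- move=> p hp; rewrite normrM normfV.
  have g0 : 2 * rho <= grad_norm h p by exact: le_grad_norm.
  rewrite (@ger0_norm _ (grad_norm _ _)) ?sqrtr_ge0//.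
  apply: ler_pM => //; first by rewrite invr_ge0 sqrtr_ge0.
    exact: FB.
  by rewrite lef_pV2// posrE; exact: lt_le_trans g0.
Qed.

End ellipse.
End collision_curve.

(** * Gaussian bounds on the collision operator *)

Section gaussian.
Context (R : realType).
Local Notation mu := (@lebesgue_measure R).

Lemma integral_gaussian (a c : R) : 0 < a ->
  (* The integrand is a multiple of the normal density with mean [c] and variance [1 / (2 a)], whose
     mass is 1. *)
  (\int[mu]_w (expR (- (a * (w - c) ^+ 2)))%:E = (Num.sqrt (pi / a))%:E)%E.
Proof.
move=> a0; pose s := Num.sqrt ((2 * a)^-1).
have s0 : s != 0 by rewrite gt_eqF// sqrtr_gt0 invr_gt0 mulr_gt0.
have s2 : s ^+ 2 = (2 * a)^-1 by rewrite sqr_sqrtr// invr_ge0 mulr_ge0// ltW.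
have a_neq0 : a != 0 by rewrite gt_eqF.
have pdfE w : normal_pdf c s w = (Num.sqrt (pi / a))^-1 * expR (- (a * (w - c) ^+ 2)).
  rewrite normal_pdfE//= /normal_peak /normal_fun s2.
  by congr ((Num.sqrt _)^-1 * expR _); field.
have pi0 : Num.sqrt (pi / a) != 0 by rewrite gt_eqF// sqrtr_gt0 divr_gt0// pi_gt0.
rewrite (_ : (fun w => (expR (- (a * (w - c) ^+ 2)))%:E) =
             (fun w => (Num.sqrt (pi / a))%:E * (normal_pdf c s w)%:E)%E); last first.
  by apply/funext => w; rewrite pdfE -EFinM mulVKf.
rewrite ge0_integralZl//=.
- by rewrite integral_normal_pdf mule1.
- by apply/measurable_EFinP; exact: measurable_normal_pdf.
- by move=> w _; rewrite lee_fin normal_pdf_ge0.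
Qed.

End gaussian.

(** * Pointwise bound on the collision integrand *)

Section bracket_bound.
Context (R : realType).

(** In both terms the cubic factor carries the whole decay [E], by equality of the two triple
    products, while the quadratic factor is bounded by [3 M^2] using only that the weights are at
    most 1. *)
Lemma bracket_bound (M E a a1 a2 a3 a4 a5 e e1 e2 e3 e4 e5 : R) : 0 <= M ->
  `|a| <= M * e -> `|a1| <= M * e1 -> `|a2| <= M * e2 ->
  `|a3| <= M * e3 -> `|a4| <= M * e4 -> `|a5| <= M * e5 ->
  0 <= e <= 1 -> 0 <= e1 <= 1 -> 0 <= e2 <= 1 ->
  0 <= e3 <= 1 -> 0 <= e4 <= 1 -> 0 <= e5 <= 1 ->
  e * e1 * e2 = E -> e3 * e4 * e5 = E ->
  `|bracket a a1 a2 a3 a4 a5| <= 6 * M ^+ 5 * E.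
Proof.
move=> M0 ha ha1 ha2 ha3 ha4 ha5 /andP[e_0 e_1] /andP[e10 e11] /andP[e20 e21]
  /andP[e30 e31] /andP[e40 e41] /andP[e50 e51] eE eE'.
have leM (x e' : R) : `|x| <= M * e' -> e' <= 1 -> `|x| <= M.
  by move=> xM e'1; apply: (le_trans xM); rewrite ler_piMr.
have prod3 (x x' x'' f f' f'' : R) : `|x| <= M * f -> `|x'| <= M * f' ->
    `|x''| <= M * f'' -> f * f' * f'' = E -> `|x * x' * x''| <= M ^+ 3 * E.
  move=> hx hx' hx'' <-; rewrite !normrM.
  rewrite (_ : M ^+ 3 * _ = (M * f) * (M * f') * (M * f'')); last by ring.
  by do 2 apply: ler_pM => //; rewrite mulr_ge0.
have sum2 (x x' x'' : R) : `|x| <= M -> `|x'| <= M -> `|x''| <= M ->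
    `|x * x' + x * x'' + x' * x''| <= 3 * M ^+ 2.
  move=> hx hx' hx''; apply: (le_trans (ler_normD _ _)).
  rewrite (_ : 3 * M ^+ 2 = (M * M + M * M) + M * M); last by ring.
  apply: lerD; last by rewrite normrM ler_pM.
  by apply: (le_trans (ler_normD _ _)); rewrite !normrM lerD// ler_pM.
have b := leM _ _ ha e_1; have b1 := leM _ _ ha1 e11; have b2 := leM _ _ ha2 e21.
have b3 := leM _ _ ha3 e31; have b4 := leM _ _ ha4 e41; have b5 := leM _ _ ha5 e51.
rewrite /bracket; apply: (le_trans (ler_normB _ _)).
rewrite (_ : 6 * M ^+ 5 * E =
  (M ^+ 3 * E) * (3 * M ^+ 2) + (M ^+ 3 * E) * (3 * M ^+ 2)); last by ring.
by apply: lerD; rewrite normrM; apply: ler_pM => //;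
  [exact: (prod3 _ _ _ e3 e4 e5)|exact: sum2|exact: (prod3 _ _ _ e e1 e2)|exact: sum2].
Qed.

End bracket_bound.

(** * The collision operator under a transported Gaussian bound *)

Section collision_bound.
Context (R : realType).
Local Notation mu := (@lebesgue_measure R).
Variables (al be s y : R).
Hypotheses (al0 : 0 < al) (be0 : 0 < be).

Definition phase_weight (w : R) : R := al * (y - s * w) ^+ 2 + be * w ^+ 2.
Local Notation q := phase_weight.

Lemma phase_weight_ge0 w : 0 <= q w.
Proof. by rewrite addr_ge0// mulr_ge0 ?sqr_ge0 ?ltW. Qed.

Lemma phase_weight_conserved v v1 v2 v3 v4 :
  Omega v v1 v2 v3 v4 (v5 v v1 v2 v3 v4) = 0 ->
  q v3 + q v4 + q (v5 v v1 v2 v3 v4) = q v + q v1 + q v2.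
Proof.
rewrite /phase_weight.
set z := v5 v v1 v2 v3 v4.
have zE : z = v + v1 + v2 - v3 - v4 by [].
rewrite /Omega => O0.
have z2 : z ^+ 2 = v ^+ 2 + v1 ^+ 2 + v2 ^+ 2 - v3 ^+ 2 - v4 ^+ 2 by lra.
have -> : (y - s * z) ^+ 2 = y ^+ 2 - 2 * y * s * z + s ^+ 2 * z ^+ 2 by ring.
by rewrite z2 zE; ring.
Qed.

Let G w : R := expR (- q w).

Let mG : measurable_fun (setT : set (measurableTypeR R)) G.
Proof.
apply: measurableT_comp => //; apply: measurable_funN; apply: measurable_funD;
  apply: measurable_funM => //; apply: measurable_funX => //.
by apply: measurable_funB => //; exact: measurable_funM.
Qed.

Lemma integral_phase_weight2 (K : R) : 0 <= K ->
  (\int[mu]_w (G w)%:E <= K%:E)%E ->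
  (\int[mu \x mu]_w (G w.1 * G w.2)%:E <= (K ^+ 2)%:E)%E.
Proof.
move=> K0 GK.
have G0 : (0 <= \int[mu]_w (G w)%:E)%E.
  by apply: integral_ge0 => w _; rewrite lee_fin expR_ge0.
have mGG : measurable_fun setT
    (fun w : measurableTypeR R * measurableTypeR R => (G w.1 * G w.2)%:E).
  by apply/measurable_EFinP; apply: measurable_funM; exact: measurableT_comp.
rewrite fubini_tonelli1//; last by move=> w; rewrite lee_fin mulr_ge0 ?expR_ge0.
rewrite /fubini_F /=.
under eq_integral => x _.
  under eq_integral do rewrite EFinM.
  rewrite ge0_integralZl//=; [|exact/measurable_EFinP|
    by move=> w _; rewrite lee_fin expR_ge0|by rewrite lee_fin expR_ge0].
  rewrite muleC; over.
rewrite ge0_integralZl//=; [|exact/measurable_EFinP|by move=> w _; rewrite lee_fin expR_ge0].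
by rewrite expr2 EFinM; apply: lee_pmul.
Qed.

Lemma integral_phase_weight_vel : (\int[mu]_w (G w)%:E <= (Num.sqrt (pi / be))%:E)%E.
Proof.
rewrite -(integral_gaussian _ be 0)//; apply: le_lower_integral => // w _.
- by rewrite lee_fin expR_ge0.
- rewrite lee_fin ler_expR lerN2 subr0 /phase_weight lerDr.
  by rewrite mulr_ge0 ?sqr_ge0// ltW.
Qed.

(** Dropping the velocity term leaves [al (y - s w)^2], a Gaussian exponent in [w] centered at
    [y / s] with coefficient [al s^2]. *)
Lemma integral_phase_weight_pos : s != 0 ->
  (\int[mu]_w (G w)%:E <= (Num.sqrt (pi / (al * s ^+ 2)))%:E)%E.
Proof.
move=> s0; rewrite -(integral_gaussian _ _ (y / s)); last first.
  by rewrite mulr_gt0// exprn_even_gt0.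
apply: le_lower_integral => // w _.
- by rewrite lee_fin expR_ge0.
- rewrite lee_fin ler_expR lerN2 /phase_weight.
  rewrite (_ : al * s ^+ 2 * _ = al * (y - s * w) ^+ 2); last by field.
  by rewrite lerDl mulr_ge0 ?sqr_ge0// ltW.
Qed.

(** The factor [12 pi] is [2 pi] from the delta integral times 6 from the bracket; [K] is the square
    of a one-variable bound, one factor for each of [v1] and [v2]. *)
Lemma C6_le (f : R -> R -> R -> R) (M K v : R) : 0 <= M ->
  (forall w, `|f s y w| <= M * expR (- q w)) ->
  (\int[mu]_w (G w)%:E <= (Num.sqrt K)%:E)%E -> 0 <= K ->
  `|C6 f s y v| <= 12 * pi * M ^+ 5 * K * expR (- q v).
Proof.
move=> M0 fM GK K0.
have GGK := integral_phase_weight2 _ (sqrtr_ge0 K) GK; rewrite sqr_sqrtr// in GGK.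
have c0 : 0 <= 12 * pi * M ^+ 5 * expR (- q v).
  by rewrite !mulr_ge0 ?pi_ge0 ?exprn_ge0 ?expR_ge0.
rewrite /C6.
apply: (@Rintegral_le_dom _ _ _ (mu \x mu)%E setT _
  (fun w => (12 * pi * M ^+ 5 * expR (- q v))%:E * (G w.1 * G w.2)%:E)%E).
  move=> [w1 w2] _ /=; rewrite -EFinM lee_fin.
  rewrite (_ : _ * (G w1 * G w2) =
    2 * pi * (6 * M ^+ 5 * (expR (- q v) * G w1 * G w2))); last by ring.
  apply: delta_integral_le.
    by rewrite !mulr_ge0 ?exprn_ge0 ?expR_ge0.
  move=> [v3 v4] /= O0.
  have e01 w : 0 <= expR (- q w) <= 1.
    by rewrite expR_ge0 -expR0 ler_expR oppr_le0 phase_weight_ge0.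
  apply: (bracket_bound _ _ _ _ _ _ _ _ _ (expR (- q v)) (G w1) (G w2) (G v3) (G v4)
     (G (v5 v w1 w2 v3 v4))) => //; try exact: e01.
  (* Conservation of the phase weight equates the Gaussian products of the incoming and outgoing
     triples. *)
  rewrite /G -!expRD.
  by rewrite -!opprD phase_weight_conserved.
rewrite ge0_integralZl//=.
- rewrite [leRHS](_ : _ = ((12 * pi * M ^+ 5 * expR (- q v))%:E * K%:E)%E); last first.
    by rewrite -EFinM; congr EFin; ring.
  by apply: lee_wpmul2l => //; rewrite lee_fin.
- by apply/measurable_EFinP; apply: measurable_funM; exact: measurableT_comp.
- by move=> w _; rewrite lee_fin mulr_ge0 ?expR_ge0.
Qed.

End collision_bound.

(** * Decay in time and scattering *)

Section decay.
Context (R : realType).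
Local Notation mu := (@lebesgue_measure R).
Variable k : R.
Hypothesis k0 : 0 < k.

(* [4 * decay s] dominates [min 1 (1 / (k * s) ^ 2)], and [- decay_tail] is a
   primitive of [decay] on the half-line. *)
Definition decay (s : R) : R := ((1 + k * `|s|) ^+ 2)^-1.
Definition decay_tail (s : R) : R := (k * (1 + k * s))^-1.

Lemma decay_ge0 s : 0 <= decay s.
Proof. by rewrite invr_ge0 sqr_ge0. Qed.

Let den_gt0 (s : R) : 0 <= s -> 0 < 1 + k * s.
Proof. by move=> s0; rewrite ltr_wpDr// mulr_ge0// ltW. Qed.

Lemma continuous_decay : continuous decay.
Proof.
move=> s; apply: cvgV; first by rewrite expf_neq0// gt_eqF// den_gt0.
apply: (@cvg_comp _ _ _ (fun s => 1 + k * `|s|) (fun s => s ^+ 2));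
  last exact: exprn_continuous.
apply: cvgD; first exact: cvg_cst.
by apply: cvgM; [exact: cvg_cst|exact: norm_continuous].
Qed.

Lemma integral_decay_le (a b : R) : 0 <= a -> a <= b ->
  (\int[mu]_(s in `[a, b]) (decay s)%:E <= (decay_tail a)%:E)%E.
Proof.
move=> a0 ab.
(* Enlarging the interval makes it nondegenerate, as the fundamental theorem of calculus asks, even
   when [a = b]. *)
apply: (@le_trans _ _ (\int[mu]_(s in `[a, (b + 1)%R]) (decay s)%:E)%E).
  apply: le_lower_integral => //.
  - by move=> x _; rewrite lee_fin decay_ge0.
  - by move=> x _; rewrite lee_fin decay_ge0.
  - by apply: subset_itvl; rewrite bnd_simp lerDl.
pose F s := - decay_tail s.
have dF (x : R) : 0 <= x -> is_derive x 1 F (decay x).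
  move=> x0.
  have idx : is_derive x 1 (@id R) 1 := is_derive_id x 1.
  have H := is_deriveZ k (is_deriveD (is_derive_cst (1 : R) x 1) (is_deriveZ k idx)).
  have den0 : (k \*: (cst 1 + k \*: (@id R)))%R x != 0.
    by rewrite /= /GRing.scale/= mulf_neq0 ?gt_eqF// den_gt0.
  apply: DeriveDef.
    exact: (@ex_derive _ _ _ _ _ _ _ (is_deriveN (is_deriveV den0 H))).
  rewrite (@derive_val _ _ _ _ _ _ _ (is_deriveN (is_deriveV den0 H))).
  rewrite /decay ger0_norm// /GRing.scale/=; have := den_gt0 x x0.
  have := k0; rewrite !lt0r => /andP[? _] /andP[? _].
  rewrite [k *: _](_ : _ = k * (1 + k * x))//.
  by field; apply/andP.
rewrite (@continuous_FTC2 _ _ F).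
- rewrite -EFinB lee_fin /F opprK gerDr oppr_le0 invr_ge0.
  by rewrite mulr_ge0 ?ltW ?den_gt0// addr_ge0// (le_trans a0).
- by apply: le_lt_trans ab _; rewrite ltrDl.
- exact/continuous_subspaceT/continuous_decay.
- have cF (x : R) : 0 <= x -> {for x, continuous F}.
    move=> x0; apply/differentiable_continuous/derivable1_diffP.
    by have := dF x x0 => ?; exact: ex_derive.
  split.
  + move=> x; rewrite in_itv/= => /andP[ax _].
    by have := dF x (le_trans a0 (ltW ax)) => ?; exact: ex_derive.
  + by apply: cvg_at_right_filter; exact: cF.
  + by apply: cvg_at_left_filter; apply: cF; rewrite addr_ge0// (le_trans a0).
- move=> x; rewrite in_itv/= => /andP[ax _].
  rewrite derive1E; have ? := dF x (le_trans a0 (ltW ax)); exact: derive_val.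
Qed.

Lemma integral_decayN_le (a b : R) : 0 <= a -> a <= b ->
  (\int[mu]_(s in `[(- b)%R, (- a)%R]) (decay s)%:E <= (decay_tail a)%:E)%E.
Proof.
move=> a0 ab; rewrite integration_by_substitution_oppr//.
  rewrite (_ : decay \o -%R = decay); first exact: integral_decay_le.
  by apply/funext => s; rewrite /decay/= normrN.
exact/continuous_subspaceT/continuous_decay.
Qed.

Variables (u : R -> R) (A : R).
Hypotheses (A0 : 0 <= A) (uA : forall s, `|u s| <= A * decay s).

Let bound_le (C : set R) c : measurable C ->
  (\int[mu]_(s in C) (decay s)%:E <= c%:E)%E ->
  (\int[mu]_(s in C) (A%:E * (decay s)%:E) <= (A * c)%:E)%E.
Proof.
move=> mC h; rewrite ge0_integralZl//=.
- by rewrite EFinM; apply: lee_wpmul2l.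
- apply/measurable_EFinP; apply: (measurable_funS measurableT) => //.
  by apply: continuous_measurable_fun; exact: continuous_decay.
- by move=> s _; rewrite lee_fin decay_ge0.
Qed.

Let uA' (C : set R) s : C s -> (`|u s|%:E <= A%:E * (decay s)%:E)%E.
Proof. by move=> _; rewrite -EFinM lee_fin. Qed.

Let subset_bound (C C' : set R) c : C `<=` C' ->
  (\int[mu]_(s in C') (decay s)%:E <= c%:E)%E ->
  (\int[mu]_(s in C) (decay s)%:E <= c%:E)%E.
Proof.
move=> CC'; apply: le_trans; apply: le_lower_integral => // s _.
- by rewrite lee_fin decay_ge0.
- by rewrite lee_fin decay_ge0.
Qed.

Lemma integral0_le (t : R) : `|Defs.integral0 u t| <= A * decay_tail 0.
Proof.
rewrite /Defs.integral0; case: ifPn => [t0|]; last rewrite -ltNge => /ltW t0.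
  apply: (@Rintegral_le_dom _ _ _ mu `[0, t] u _ _ (uA' _)); apply: bound_le => //.
  exact: integral_decay_le.
rewrite normrN; apply: (@Rintegral_le_dom _ _ _ mu `[t, 0] u _ _ (uA' _)).
apply: bound_le => //.
by have := integral_decayN_le 0 (- t); rewrite opprK oppr0; apply; rewrite // oppr_ge0.
Qed.

Lemma integral0_tail_le (a b : R) : 0 <= a -> a <= b ->
  `|Defs.integral0 u b - Defs.integral0 u a| <= A * decay_tail a.
Proof.
move=> a0 ab; rewrite /Defs.integral0 a0 (le_trans a0 ab).
apply: (@Rintegral_setD_dom _ _ _ mu `[0, a] `[0, b] u _ _ _ _ _ _ (uA' _)
  (bound_le _ _ _ (integral_decay_le 0 b _ _))) => //.
- by apply: subset_itvl; rewrite bnd_simp.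
- exact: le_trans ab.
- apply: bound_le; first exact: measurableD.
  apply: (@subset_bound _ `[a, b]); last exact: integral_decay_le.
  move=> x [/=]; rewrite !in_itv/= => /andP[-> ->] /=; rewrite andbT => xa.
  by rewrite leNgt; apply/negP => /ltW.
Qed.

(** Strict positivity of [a] puts both times on the negative branch of [integral0]. *)
Lemma integral0N_tail_le (a b : R) : 0 < a -> a <= b ->
  `|Defs.integral0 u (- b) - Defs.integral0 u (- a)| <= A * decay_tail a.
Proof.
move=> a0 ab; rewrite /Defs.integral0 !oppr_ge0 (lt_geF a0) (lt_geF (lt_le_trans a0 ab)).
rewrite -opprD normrN.
have h := integral_decayN_le 0 b (lexx 0) (ltW (lt_le_trans a0 ab)).
rewrite oppr0 in h.
apply: (@Rintegral_setD_dom _ _ _ mu `[- a, 0] `[- b, 0] u _ _ _ _ _ _ (uA' _)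
  (bound_le _ _ _ h)) => //.
- by apply: subset_itvr; rewrite bnd_simp lerN2.
- apply: bound_le; first exact: measurableD.
  apply: (@subset_bound _ `[- b, - a]); last by apply: integral_decayN_le => //; exact: ltW.
  move=> x [/=]; rewrite !in_itv/= => /andP[-> ->] /=; rewrite andbT => xa.
  by rewrite leNgt; apply/negP => /ltW.
Qed.

End decay.

(** * Limits of families that are Cauchy in the weighted norm *)

Section asymptotic_state.
Context (R : realType).
Variables (al be : R).

Definition gauss_weight (x v : R) : R := expR (al * x ^+ 2 + be * v ^+ 2).

Lemma wnorm_leP (g : R -> R -> R) (c : R) :
  (wnorm al be g <= c%:E)%E <-> forall x v, `|g x v| * gauss_weight x v <= c.
Proof.
split=> [gc x v|gc].
  rewrite -lee_fin; apply: le_trans gc; apply: ereal_sup_ubound.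
  by exists (x, v).
by apply: ge_ereal_sup => _ [[x v] _ <-]; rewrite lee_fin; exact: gc.
Qed.

Lemma wnorm_ge0 (g : R -> R -> R) : (0 <= wnorm al be g)%E.
Proof.
apply: (@le_trans _ _ (`|g 0 0| * gauss_weight 0 0)%:E).
  by rewrite lee_fin mulr_ge0 ?expR_ge0.
by apply: ereal_sup_ubound; exists (0, 0).
Qed.

Lemma wnorm_fin (g : R -> R -> R) : (wnorm al be g < +oo)%E ->
  exists2 c : R, wnorm al be g = c%:E & 0 <= c.
Proof.
have := wnorm_ge0 g; case: (wnorm al be g) => // r; rewrite lee_fin => r0 _.
by exists r.
Qed.

Variables (D : R -> R -> R -> R) (f0 : R -> R -> R) (r : R) (eps : R -> R).
Hypotheses
  (mD : forall t, measurable_fun [set: R * R] (fun p : R * R => D t p.1 p.2))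
  (f0r : inB al be r f0)
  (Df0 : forall t x v, `|D t x v - f0 x v| * gauss_weight x v <= r)
  (Dtail : forall a b x v, 0 < a -> a <= b ->
     `|D b x v - D a x v| * gauss_weight x v <= eps a)
  (eps0 : eps t @[t --> +oo%R] --> (0 : R)).

Let W_gt0 x v : 0 < gauss_weight x v. Proof. exact: expR_gt0. Qed.

Let D_cvg x v : cvg (D n%:R x v @[n --> \oo]).
Proof.
apply/cauchy_cvgP/cauchy_exP => e e0.
have eW : 0 < e * gauss_weight x v by rewrite mulr_gt0.
have /cvgrPdist_lt/(_ _ eW) := eps0.
move=> [N [_ HN]].
(* A successor, because [Dtail] starts from a positive time. *)
have [n nN] : exists n, N < n.+1%:R.
  exists (Num.bound `|N|); apply: (le_lt_trans (ler_norm _)).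
  by apply: lt_trans (archi_boundP (normr_ge0 _)) _; rewrite ltr_nat.
exists (D n.+1%:R x v); exists n.+1 => // m /= nm.
rewrite /ball/= distrC -(ltr_pM2r (W_gt0 x v)).
have := HN _ nN; rewrite sub0r normrN; apply: le_lt_trans.
apply: le_trans (ler_norm _); apply: Dtail => //.
by rewrite ler_nat.
Qed.

(** Integer times make the limit measurable as a limit of a sequence; the tail bound then extends
    the convergence to real times. *)
Definition limit_state x v : R := lim (D n%:R x v @[n --> \oo]).

Let D_limit_near (g : R) x v c :
  (\forall n \near \oo, `|D n%:R x v - g| * gauss_weight x v <= c) ->
  `|limit_state x v - g| * gauss_weight x v <= c.
Proof.
move=> H; apply: cvgr_to_le H.
apply: cvgMl; apply: cvg_norm; apply: cvgB; [exact: D_cvg|exact: cvg_cst].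
Qed.

Lemma limit_state_dist t x v : 0 < t ->
  `|D t x v - limit_state x v| * gauss_weight x v <= eps t.
Proof.
move=> t0; rewrite distrC; apply: D_limit_near.
exists (Num.bound t) => // n /= tn; apply: Dtail => //.
by apply: ltW; apply: lt_le_trans (archi_boundP (ltW t0)) _; rewrite ler_nat.
Qed.

Lemma limit_state_cvg :
  wnorm al be (fun x v => D t x v - limit_state x v) @[t --> +oo%R] --> 0%E.
Proof.
apply: (@squeeze_cvge _ _ _ _ (cst 0%E) _ (EFin \o eps)).
- near=> t; rewrite wnorm_ge0/=; apply/wnorm_leP => x v.
  by apply: limit_state_dist; near: t; exact: nbhs_pinfty_gt.
- exact: cvg_cst.
- by apply: cvg_EFin => //; exact: nearW.
Unshelve. all: by end_near. Qed.

(** The norm [c] of [f0] is strictly below [r] and the limit stays within [r] of [f0], so its norm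
    is at most [c + r < 2 r]. *)
Lemma limit_state_inB : inB al be (2 * r) limit_state.
Proof.
have [[mf0 _] f0ltr] := f0r.
have [c f0c c0] := wnorm_fin _ (lt_trans f0ltr (ltry r)).
have cr : c < r by rewrite -lte_fin -f0c.
have lcr : (wnorm al be limit_state <= (c + r)%:E)%E.
  apply/wnorm_leP => x v.
  rewrite (_ : limit_state x v = f0 x v + (limit_state x v - f0 x v));
    last by rewrite addrC subrK.
  apply: (le_trans (ler_wpM2r (ltW (W_gt0 x v)) (ler_normD _ _))).
  rewrite mulrDl; apply: lerD.
    by move: x v; apply/wnorm_leP; rewrite f0c.
  by apply: D_limit_near; apply: nearW => n; exact: Df0.
have lt2 : (wnorm al be limit_state < (2 * r)%:E)%E.
  by apply: (le_lt_trans lcr); rewrite lte_fin; lra.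
split => //; split; last exact: lt_trans lt2 (ltry _).
apply: (@measurable_fun_cvg _ _ _ _ (fun n p => D n%:R p.1 p.2)) => //.
Qed.

Let pointwise_close (g : R -> R -> R) (e x v : R) : 0 < e ->
  wnorm al be (fun x v => D t x v - g x v) @[t --> +oo%R] --> 0%E ->
  \forall t \near +oo%R, `|D t x v - g x v| * gauss_weight x v <= e.
Proof.
move=> e0 /fine_cvgP[gfin /cvgrPdist_lt/(_ _ e0) g0].
near=> t; apply: (proj1 (wnorm_leP (fun x v => D t x v - g x v) e)).
rewrite -(@fineK _ (wnorm _ _ _)); last by near: t.
rewrite lee_fin; apply: le_trans (ler_norm _) _; apply: ltW.
by rewrite -normrN -sub0r; near: t; exact: g0.
Unshelve. all: by end_near. Qed.

Lemma limit_state_uniq (g h : R -> R -> R) :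
  wnorm al be (fun x v => D t x v - g x v) @[t --> +oo%R] --> 0%E ->
  wnorm al be (fun x v => D t x v - h x v) @[t --> +oo%R] --> 0%E ->
  g = h.
Proof.
move=> g0 h0; apply/funext => x; apply/funext => v.
apply/eqP; rewrite -subr_eq0 -normr_le0 -(@pmulr_lle0 _ (gauss_weight x v))//.
apply/ler_addgt0Pr => e e0; rewrite add0r.
have e20 : 0 < e / 2 by rewrite divr_gt0.
have [t [dg dh]] := filter_ex (filterI (pointwise_close _ _ x v e20 g0)
                                       (pointwise_close _ _ x v e20 h0)).
have -> : g x v - h x v = (D t x v - h x v) - (D t x v - g x v) by ring.
apply: (le_trans (ler_wpM2r (ltW (W_gt0 x v)) (ler_normB _ _))).
by rewrite mulrDl [e]splitr; exact: lerD.
Qed.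

Lemma exists_unique_limit_state : exists! fp : R -> R -> R,
  inB al be (2 * r) fp /\
  wnorm al be (fun x v => D t x v - fp x v) @[t --> +oo%R] --> 0%E.
Proof.
exists limit_state; split; first by split; [exact: limit_state_inB|exact: limit_state_cvg].
by move=> g [_ gl]; apply: limit_state_uniq => //; exact: limit_state_cvg.
Qed.

End asymptotic_state.

(** * Time decay along the flow and scattering *)

Section scattering.
Context (R : realType).
Variables (al be M : R) (f0 : R -> R -> R) (f : R -> R -> R -> R).
Hypotheses (al0 : 0 < al) (be0 : 0 < be) (M0 : 0 <= M).
Hypothesis fM : (tnorm al be (untransport f) <= M%:E)%E.

(** Inverse of the crossover time: the bounds [pi / be] and [pi / (al s^2)] coincide when
    [kap |s| = 1]. *)
Let kap := Num.sqrt al / Num.sqrt be.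
(* [12 pi M^5] from the collision integrand times [4 pi / be] from [decay] *)
Let A := 48 * pi ^+ 2 * M ^+ 5 / be.

Let kap0 : 0 < kap. Proof. by rewrite divr_gt0 ?sqrtr_gt0. Qed.

Let A0 : 0 <= A.
Proof.
apply: divr_ge0; last exact: ltW.
by rewrite mulr_ge0 ?exprn_ge0// mulr_ge0 ?sqr_ge0.
Qed.

Lemma gaussian_bound t y w :
  `|f t y w| <= M * expR (- phase_weight R al be t y w).
Proof.
have /wnorm_leP/(_ (y - t * w) w) : (wnorm al be (untransport f t) <= M%:E)%E.
  by apply: le_trans fM; apply: ereal_sup_ubound; exists t.
rewrite /untransport /transport mulNr opprK subrK /gauss_weight => h.
by rewrite expRN -ler_pdivlMr ?expR_gt0// in h *.
Qed.

Lemma C6_transport_le x v s :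
  `|transport (- s) (C6 f) s x v| <=
  A * expR (- (al * x ^+ 2 + be * v ^+ 2)) * decay R kap s.
Proof.
rewrite /transport mulNr opprK.
have qE : phase_weight R al be s (x + s * v) v = al * x ^+ 2 + be * v ^+ 2.
  by rewrite /phase_weight addrK.
have den0 : 0 < 1 + kap * `|s| by rewrite ltr_wpDr// mulr_ge0// ltW.
have [K [K0 GK KA]] : exists K, [/\ 0 <= K,
    (\int[lebesgue_measure]_w
      (expR (- phase_weight R al be s (x + s * v) w))%:E <= (Num.sqrt K)%:E)%E &
    K <= 4 * pi / be * decay R kap s].
  (* With [z = kap |s|], the velocity bound is used for [z <= 1], where [(1 + z)^2 <= 4], and the
     position bound for [z > 1], where [(1 + z)^2 <= 4 z^2]. *)
  have [ks|ks] := leP (kap * `|s|) 1.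
    exists (pi / be); split; first by rewrite divr_ge0 ?pi_ge0// ltW.
      exact: integral_phase_weight_vel.
    rewrite /decay ler_pdivlMr ?exprn_gt0// [leLHS]mulrC.
    rewrite -mulrA; apply: ler_wpM2r; first by rewrite divr_ge0 ?pi_ge0// ltW.
    have : 0 <= kap * `|s| by rewrite mulr_ge0// ltW.
    move: ks; move: (kap * `|s|) => z z1 z0.
    by nra.
  have s0 : s != 0 by apply: contraTneq ks => ->; rewrite normr0 mulr0 -leNgt.
  have s2 : 0 < s ^+ 2 by rewrite exprn_even_gt0.
  have als2 : 0 < al * s ^+ 2 := mulr_gt0 al0 s2.
  exists (pi / (al * s ^+ 2)); split.
  - by rewrite divr_ge0 ?pi_ge0// ltW.
  - exact: integral_phase_weight_pos.
  - rewrite /decay ler_pdivlMr ?exprn_gt0// mulrAC ler_pdivrMr//.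
    have -> : 4 * pi / be * (al * s ^+ 2) = pi * (4 * (kap * `|s|) ^+ 2).
      rewrite exprMn real_normK ?num_real// /kap expr_div_n !sqr_sqrtr ?ltW//.
      by field; rewrite gt_eqF.
    rewrite ler_wpM2l ?pi_ge0//; move: ks; move: (kap * `|s|) => z z1.
    by nra.
apply: (le_trans (C6_le R al be s _ al0 be0 f M K v M0 (gaussian_bound s _) GK K0)).
rewrite qE [leRHS]mulrAC; apply: ler_wpM2r; first exact: expR_ge0.
apply: (@le_trans _ _ (12 * pi * M ^+ 5 * (4 * pi / be * decay R kap s))).
  by apply: ler_wpM2l => //; rewrite !mulr_ge0 ?pi_ge0 ?exprn_ge0.
rewrite le_eqVlt; apply/orP; left; apply/eqP; rewrite /A; ring.
Qed.

Hypothesis f_mild : mild_solution al be f0 f.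

Let D := untransport f.

Let weightE x v : expR (- (al * x ^+ 2 + be * v ^+ 2)) * gauss_weight R al be x v = 1.
Proof. by rewrite /gauss_weight -expRD addNr expR0. Qed.

Let DE t x v : D t x v =
  f0 x v + Defs.integral0 (fun s => transport (- s) (C6 f) s x v) t.
Proof. by case: f_mild. Qed.

Let Ax0 x v : 0 <= A * expR (- (al * x ^+ 2 + be * v ^+ 2)).
Proof. by rewrite mulr_ge0 ?expR_ge0. Qed.

Let weight_le x v d e : d <= A * expR (- (al * x ^+ 2 + be * v ^+ 2)) * e ->
  d * gauss_weight R al be x v <= A * e.
Proof.
move=> h; apply: (le_trans (ler_wpM2r (expR_ge0 _) h)).
by rewrite mulrAC -(mulrA A) weightE mulr1.
Qed.

Lemma untransport_dist_initial t x v :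
  `|D t x v - f0 x v| * gauss_weight R al be x v <= A * decay_tail R kap 0.
Proof.
apply: weight_le; rewrite DE addrAC subrr add0r.
exact: (integral0_le R kap kap0 _ _ (Ax0 x v) (C6_transport_le x v)).
Qed.

Lemma untransport_tail a b x v : 0 < a -> a <= b ->
  `|D b x v - D a x v| * gauss_weight R al be x v <= A * decay_tail R kap a.
Proof.
move=> a0 ab; apply: weight_le; rewrite !DE opprD addrACA subrr add0r.
exact: (integral0_tail_le R kap kap0 _ _ (Ax0 x v) (C6_transport_le x v)
  _ _ (ltW a0)).
Qed.

Lemma untransport_tailN a b x v : 0 < a -> a <= b ->
  `|D (- b) x v - D (- a) x v| * gauss_weight R al be x v <= A * decay_tail R kap a.
Proof.
move=> a0 ab; apply: weight_le; rewrite !DE opprD addrACA subrr add0r.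
exact: (integral0N_tail_le R kap kap0 _ _ (Ax0 x v) (C6_transport_le x v) _ _ a0).
Qed.

Lemma decay_tail_cvg0 : A * decay_tail R kap t @[t --> +oo%R] --> (0 : R).
Proof.
apply/cvgrPdist_lt => e e0; near=> t.
have t0 : 0 < t by near: t; exact: nbhs_pinfty_gt.
have kt : 0 < kap * (1 + kap * t) by rewrite mulr_gt0// ltr_wpDr// mulr_ge0 ?ltW.
rewrite sub0r normrN /decay_tail ger0_norm; last by rewrite divr_ge0// ltW.
rewrite ltr_pdivrMr//.
(* From this time on, the term [e kap^2 t] of the expanded denominator already exceeds [A]. *)
have : A / (e * kap ^+ 2) < t by near: t; apply: nbhs_pinfty_gt; rewrite num_real.
rewrite ltr_pdivrMr; last by rewrite pmulr_rgt0// exprn_gt0.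
move=> At.
apply: (lt_trans At); rewrite -subr_gt0.
have -> : e * (kap * (1 + kap * t)) - t * (e * kap ^+ 2) = e * kap by ring.
exact: mulr_gt0.
Unshelve. all: by end_near. Qed.

Let mD t : measurable_fun [set: R * R] (fun p : R * R => D t p.1 p.2).
Proof.
case: f_mild => _ [mDf _] _.
apply: (measurableT_comp mDf (_ : measurable_fun setT (fun p : R * R => (t, p.1, p.2)))).
by apply: measurable_fun_pair => //; apply: measurable_fun_pair.
Qed.

Lemma scattering (r : R) : A * decay_tail R kap 0 <= r -> inB al be r f0 ->
  (exists! fp : R -> R -> R,
     inB al be (2 * r) fp /\
     wnorm al be (fun x v => untransport f t x v - fp x v)
       @[t --> +oo%R] --> 0%E) /\
  (exists! fm : R -> R -> R,
     inB al be (2 * r) fm /\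
     wnorm al be (fun x v => untransport f t x v - fm x v)
       @[t --> -oo%R] --> 0%E).
Proof.
move=> Ar f0r.
have D0 t x v : `|D t x v - f0 x v| * gauss_weight R al be x v <= r.
  exact: le_trans (untransport_dist_initial t x v) Ar.
split.
  exact: (exists_unique_limit_state _ _ _ _ _ _ _ mD f0r D0
    untransport_tail decay_tail_cvg0).
(* The limit at minus infinity is the limit at plus infinity of the time-reversed family. *)
have [fm [[fmB fml] fmu]] := exists_unique_limit_state R al be (fun t => D (- t)) f0 r _
  (fun t => mD (- t)) f0r (fun t => D0 (- t)) untransport_tailN decay_tail_cvg0.
exists fm; split; first by split => //; apply/cvgNy_compNP.
by move=> g [gB /cvgNy_compNP gl]; apply: fmu.
Qed.

End scattering.

(** * The smallness threshold and the conclusion *)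

Lemma decay_tail0_le (R : realType) (al be Rs : R) : 0 < al -> 0 < be -> 0 < Rs ->
  Rs <= al `^ (1 / 8) / (2 `^ (7 / 2) * C1beta (pi ^+ 2) be `^ (1 / 4)) ->
  48 * pi ^+ 2 * (2 * Rs) ^+ 5 / be *
    decay_tail R (Num.sqrt al / Num.sqrt be) 0 <= Rs.
Proof.
move=> al0 be0 Rs0 Rsle.
set a := Num.sqrt al; set b := Num.sqrt be.
have a0 : 0 < a by rewrite sqrtr_gt0.
have b0 : 0 < b by rewrite sqrtr_gt0.
have bE : be = b ^+ 2 by rewrite sqr_sqrtr// ltW.
have pi0 : 0 < pi ^+ 2 :> R by rewrite exprn_gt0// pi_gt0.
set C := C1beta (pi ^+ 2) be in Rsle.
(* From [2^(-1/2) >= 1/2] and [2 / b <= 1 / b^2 + 1], the latter by expanding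
   [(1 / b - 1)^2 >= 0]. *)
have Cge : pi ^+ 2 / b <= C.
  rewrite /C /C1beta.
  have -> : (2 : R) `^ (- (1 / 2)) = (Num.sqrt 2)^-1.
    by rewrite powRN div1r powR12_sqrt.
  have s2 : 2^-1 <= (Num.sqrt 2 : R)^-1.
    rewrite lef_pV2 ?posrE ?sqrtr_gt0// -[leRHS]ger0_norm// -sqrtr_sqr ler_wsqrtr//.
    by rewrite expr2; lra.
  have hb : 2 * b^-1 <= be^-1 + 1.
    rewrite bE -exprVn; have := sqr_ge0 (b^-1 - 1); nra.
  rewrite [leRHS](_ : _ = pi ^+ 2 * ((Num.sqrt 2)^-1 * (be^-1 + 1))); last by ring.
  apply: ler_wpM2l; first exact: ltW.
  apply: (@le_trans _ _ (2^-1 * (2 * b^-1))); first by rewrite mulKf.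
  by apply: ler_pM => //; rewrite mulr_ge0// invr_ge0 ltW.
have C0 : 0 < C by apply: lt_le_trans Cge; rewrite divr_gt0.
(* The fourth power of the hypothesis clears all fractional exponents except the square root [a] of
   [al]. *)
have Rs4 : Rs ^+ 4 <= a / (2 ^+ 14 * C).
  have -> : a / (2 ^+ 14 * C) =
      (al `^ (1 / 8) / (2 `^ (7 / 2) * C `^ (1 / 4))) ^+ 4.
    rewrite expr_div_n exprMn -!powR_mulrn ?powR_ge0// -!powRrM.
    rewrite (_ : 1 / 8 * 4 = 2^-1); last by field.
    rewrite (_ : 7 / 2 * 4 = 14%:R); last by field.
    rewrite (_ : 1 / 4 * 4 = 1); last by field.
    by rewrite powR12_sqrt ?ltW// powRr1 ?ltW// powR_mulrn.
  rewrite ler_pXn2r// nnegrE; first exact: ltW.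
  exact: le_trans (ltW Rs0) Rsle.
have Rs4' : Rs ^+ 4 * (2 ^+ 14 * pi ^+ 2) <= a * b.
  move: Rs4; rewrite ler_pdivlMr; last by rewrite mulr_gt0// exprn_gt0.
  move=> h; rewrite -ler_pdivrMr//; apply: le_trans h.
  rewrite [leLHS](_ : _ = Rs ^+ 4 * (2 ^+ 14 * (pi ^+ 2 / b)));
    last by rewrite !mulrA.
  apply: ler_wpM2l; first by apply: exprn_ge0; exact: ltW.
  by apply: ler_wpM2l => //; exact: exprn_ge0.
rewrite /decay_tail mulr0 addr0 mulr1 invf_div bE.
(* Here [1536 = 48 * 2^5]; the claim then reduces to [1536 <= 2^14]. *)
have -> : 48 * pi ^+ 2 * (2 * Rs) ^+ 5 / b ^+ 2 * (b / a) =
   Rs * (1536 * (Rs ^+ 4 * pi ^+ 2)) / (a * b).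
  by field; rewrite !gt_eqF.
rewrite ler_pdivrMr ?mulr_gt0//; apply: ler_wpM2l; first exact: ltW.
apply: le_trans Rs4'.
have : 0 <= Rs ^+ 4 * pi ^+ 2.
  by apply: mulr_ge0; [apply: exprn_ge0; exact: ltW|exact: ltW].
rewrite !exprS expr0; nra.
Qed.

Theorem theorem2p8 (R : realType) :
  exists C1 : R, 0 < C1 /\
  forall (alpha beta Rs : R), 0 < alpha -> 0 < beta -> 0 < Rs ->
  Rs <= alpha `^ (1 / 8) / (2 `^ (7 / 2) * C1beta C1 beta `^ (1 / 4)) ->
  forall (f0 : R -> R -> R) (f : R -> R -> R -> R),
  inB alpha beta Rs f0 ->
  mild_solution alpha beta f0 f ->
  (tnorm alpha beta (untransport f) <= (2 * Rs)%:E)%E ->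
  (exists! fp : R -> R -> R,
     inB alpha beta (2 * Rs) fp /\
     wnorm alpha beta (fun x v => untransport f t x v - fp x v)
       @[t --> +oo%R] --> 0%E) /\
  (exists! fm : R -> R -> R,
     inB alpha beta (2 * Rs) fm /\
     wnorm alpha beta (fun x v => untransport f t x v - fm x v)
       @[t --> -oo%R] --> 0%E).
Proof.
(* the estimates need [C1 >= (1536 / 2 ^ 14) pi ^ 2] *)
exists (pi ^+ 2); split; first by rewrite exprn_gt0// pi_gt0.
move=> al be Rs al0 be0 Rs0 Rsle f0 f f0B fmild fM.
apply: (scattering R al be (2 * Rs) f0 f al0 be0 _ fM fmild) => //.
  by rewrite mulr_ge0// ltW.
exact: decay_tail0_le.
Qed.
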